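(* Let $\ell\ge1$ be an integer. For $r>0$ and $0\le w\le 1$ let \[ \Psi_r(w)=\frac{(1+\ell w)^r+1+\ell w^r}{\bigl(2+2\ell w+\ell(\ell+1)w^2\bigr)^{r/2}}, \] and for $0<w<1$ and $r>0$ let \[ \Delta_w(r)=(1-w)(1+\ell w)^{r-1}+(2+\ell w)w^{r-1}-\bigl(1+(\ell+1)w\bigr). \] For each $0<w<1$, the function $r\mapsto\Delta_w(r)$ is strictly convex on $(0,\infty)$ and satisfies \[ \Delta_w(1)=2(1-w),\qquad \Delta_w(2)=0. \] Consequently, if $0<r<1$, then $\Psi_r$ is strictly increasing on $[0,1]$. Moreover: (1) If $\ell=1$, then $\Psi_r$ is strictly increasing on $[0,1]$ for $1<r<2$ and for $r>4$, strictly decreasing on $[0,1]$ for $2<r<4$, and \[ \Psi_2(w)\equiv 1,\qquad \Psi_4(w)\equiv\tfrac12 . \] In particular, for every $r>0$, the extrema of $\Psi_r$ on $[0,1]$ are attained at the endpoints. (2) If $\ell\ge2$ and $r\ge3$, then $\Psi_r$ is strictly increasing on $[0,1]$.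
   Context: Here $0^r=0$ for $r>0$, so that $\Psi_r(0)=2^{1-r/2}$. *)

(* Defs.v *)
From mathcomp Require Import all_boot all_order all_algebra.
From mathcomp Require Import reals exp.

Set Implicit Arguments.
Unset Strict Implicit.
Unset Printing Implicit Defensive.

Import Order.TTheory GRing.Theory Num.Theory.
Local Open Scope ring_scope.

(* Real exponents are rendered by [powR], for which [0 `^ r = 0] as soon as
   [r != 0] (lemma [powR0]), in accordance with the convention 0^r = 0 for
   r > 0. *)
Definition Psi (R : realType) (l : nat) (r w : R) : R :=
  ((1 + l%:R * w) `^ r + 1 + l%:R * w `^ r) /
  (2 + 2 * l%:R * w + l%:R * (l%:R + 1) * w ^+ 2) `^ (r / 2).

Definition Delta (R : realType) (l : nat) (w r : R) : R :=
  (1 - w) * (1 + l%:R * w) `^ (r - 1) + (2 + l%:R * w) * w `^ (r - 1)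
  - (1 + (l%:R + 1) * w).

Definition strictly_convex_on (R : realType) (i : interval R) (f : R -> R) :=
  forall x y t : R, x \in i -> y \in i -> x != y -> 0 < t < 1 ->
    f (t * x + (1 - t) * y) < t * f x + (1 - t) * f y.

Lemma Psi_at0 (R : realType) (l : nat) (r : R) :
  0 < r -> Psi l r 0 = 2 `^ (1 - r / 2).
Proof.
move=> r0; rewrite /Psi !mulr0 expr0n mulr0 !addr0 powR1 powR0 ?gt_eqF//.
by rewrite mulr0 addr0 powRB ?pnatr_eq0 ?implybT// powRr1.
Qed.

(* Main.v *)
Require Import Defs.
From mathcomp Require Import all_boot all_order all_algebra.
From mathcomp Require Import ring lra.
From mathcomp Require Import all_classical all_reals all_analysis.

Set Implicit Arguments.
Unset Strict Implicit.
Unset Printing Implicit Defensive.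

Import Order.TTheory GRing.Theory Num.Theory.
Import numFieldNormedType.Exports.
Local Open Scope ring_scope.

(** The derivative of [Psi l r] on ]0, 1[ is [Delta l w r] times a positive
    factor: writing [Psi = N * D `^ (- (r / 2))], the combination
    [N' * D - (r / 2) * N * D'] equals [r * l * Delta], because
    [D - (1 + l w) (1 + (l + 1) w) = 1 - w] and
    [D - l w (1 + (l + 1) w) = 2 + l w].  As [Psi] is continuous up to the
    endpoints, its monotonicity on [0, 1] reduces to the sign of [Delta]
    ([Psi_incr], [Psi_decr]).

    That sign comes from convexity in the exponent.  For [w] in ]0, 1[, [Delta]
    is a positive combination of two exponentials in [r], plus a constant,
    hence strictly convex.  A strictly convex function that is nonpositive at two
    points is negative strictly between them ([strictly_convex_lt0]); read
    contrapositively, this also gives positivity outside an interval.  So the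
    sign is decided by the values at a few integers, where [Delta] is a
    polynomial in [w]:
    - [Delta = 0] at 2 and [Delta > 0] at 1, hence [Delta > 0] on ]0, 1[;
    - for [l = 1], [Delta] also vanishes at 4, hence it is negative on ]2, 4[
      and positive before 2 and after 4;
    - for [l >= 2], [Delta > 0] at 3, hence also beyond 3.

    For [l = 1] and every [r > 0], [Psi] is then strictly monotone or constant,
    and so takes its extreme values at the endpoints. *)

(** * Strict convexity in the exponent *)

(** Besides its direct use, this excludes [f a <= 0] when [f b <= 0 <= f c],
    and likewise with [a] and [b] exchanged; so it also shows that values beyond
    two known ones are positive. *)
Lemma strictly_convex_lt0 (R : realType) (i : interval R) (f : R -> R)
    (a b c : R) :
  strictly_convex_on i f -> a \in i -> b \in i -> a < c < b ->
  f a <= 0 -> f b <= 0 -> f c < 0.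
Proof.
move=> cvxf ai bi /andP[ac cb] fa fb.
have ab : 0 < b - a by lra.
set t := (b - c) / (b - a).
have t01 : 0 < t < 1.
  by rewrite /t divr_gt0 ?ltr_pdivrMr ?mul1r//=; lra.
have -> : c = t * a + (1 - t) * b by rewrite /t; field; lra.
apply: (lt_le_trans (cvxf _ _ _ ai bi _ t01)); first by rewrite lt_eqF//; lra.
have [t0 t1] : 0 <= t /\ 0 <= 1 - t by lra.
by have := mulr_ge0_le0 t0 fa; have := mulr_ge0_le0 t1 fb; lra.
Qed.

Lemma expR_tangent (R : realType) (m u : R) :
  u != m -> expR m * (1 + (u - m)) < expR u.
Proof.
move=> um; have -> : expR u = expR m * expR (u - m) by rewrite -expRD subrKC.
by rewrite ltr_pM2l ?expR_gt0// expR_gt1Dx// subr_eq0.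
Qed.

(** Here the exponential [s |-> expR ((s - 1) * ln a)] is compared at [x] and
    [y] with its tangent at the intermediate point; [a != 1] makes [ln a]
    nonzero, so that both comparisons are strict. *)
Lemma powR_strictly_convex (R : realType) (i : interval R) (a : R) :
  0 < a -> a != 1 -> strictly_convex_on i (fun s => a `^ (s - 1)).
Proof.
move=> a0 a1 x y t _ _ xy /andP[t0 t1].
rewrite /powR gt_eqF//.
have lna : ln a != 0 by rewrite ln_eq0.
have t0' : t != 0 by rewrite gt_eqF.
have t1' : 1 - t != 0 by rewrite subr_eq0 gt_eqF.
have xy' : x - y != 0 by rewrite subr_eq0.
set m := (_ - 1) * ln a.
have hx : (x - 1) * ln a != m.
  rewrite -subr_eq0.
  have -> : (x - 1) * ln a - m = (1 - t) * (x - y) * ln a by rewrite /m; ring.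
  by rewrite !mulf_neq0.
have hy : (y - 1) * ln a != m.
  rewrite -subr_eq0.
  have -> : (y - 1) * ln a - m = t * (y - x) * ln a by rewrite /m; ring.
  by rewrite !mulf_neq0// -opprB oppr_eq0.
have tx : t * (expR m * (1 + ((x - 1) * ln a - m)))
    < t * expR ((x - 1) * ln a).
  by rewrite ltr_pM2l// expR_tangent.
have ty : (1 - t) * (expR m * (1 + ((y - 1) * ln a - m)))
    < (1 - t) * expR ((y - 1) * ln a).
  by rewrite ltr_pM2l ?subr_gt0// expR_tangent.
apply: le_lt_trans (ltrD tx ty).
by rewrite le_eqVlt; apply/orP; left; apply/eqP; rewrite /m; ring.
Qed.

Lemma Delta_strictly_convex (R : realType) (l : nat) (w : R) :
  (1 <= l)%N -> 0 < w < 1 -> strictly_convex_on `]0, +oo[ (Delta l w).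
Proof.
move=> hl /andP[w0 w1] x y t xi yi xy t01.
have l1 : (1 : R) <= l%:R by rewrite ler1n.
have lw : 0 < l%:R * w by rewrite mulr_gt0//; lra.
have A0 : 0 < 1 - w by lra.
have B0 : 0 < 2 + l%:R * w by lra.
have a0 : 0 < 1 + l%:R * w by lra.
have a1 : 1 + l%:R * w != 1 by rewrite gt_eqF//; lra.
have := @powR_strictly_convex R _ _ a0 a1 x y t xi yi xy t01.
rewrite -(ltr_pM2l A0) => ha.
have := @powR_strictly_convex R _ _ w0 (negbT (lt_eqF w1)) x y t xi yi xy t01.
rewrite -(ltr_pM2l B0) => hb.
by rewrite /Delta; lra.
Qed.

(** * The sign of [Delta] *)

Lemma Delta_natE (R : realType) (l n : nat) (w : R) : 0 < w ->
  Delta l w n.+1%:R =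
  (1 - w) * (1 + l%:R * w) ^+ n + (2 + l%:R * w) * w ^+ n
  - (1 + (l%:R + 1) * w).
Proof.
move=> w0; rewrite /Delta -natr1 addrK !powR_mulrn ?ltW//.
by rewrite ltr_wpDr// mulr_ge0// ltW.
Qed.

Lemma Delta_at1 (R : realType) (l : nat) (w : R) : 0 < w ->
  Delta l w 1 = 2 * (1 - w).
Proof. by move=> w0; rewrite (@Delta_natE R l 0)// !expr0; ring. Qed.

Lemma Delta_at2 (R : realType) (l : nat) (w : R) : 0 < w -> Delta l w 2 = 0.
Proof. by move=> w0; rewrite (@Delta_natE R l 1)// !expr1; ring. Qed.

(** The last factor carries the sign: it is positive for [l >= 2], but [-1]
    for [l = 1]. *)
Lemma Delta_at3 (R : realType) (l : nat) (w : R) : 0 < w ->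
  Delta l w 3 = w * (1 - w) * (l%:R - 2 + l%:R * (l%:R - 1) * w).
Proof. by move=> w0; rewrite (@Delta_natE R l 2)//; ring. Qed.

Lemma Delta1_at4 (R : realType) (w : R) : 0 < w -> Delta 1 w 4 = 0.
Proof. by move=> w0; rewrite (@Delta_natE R 1 3)//; ring. Qed.

(** Nonpositive values at [r < 1] and at 2 would force a negative value at 1. *)
Lemma Delta_gt0_left (R : realType) (l : nat) (w r : R) :
  (1 <= l)%N -> 0 < w < 1 -> 0 < r < 1 -> 0 < Delta l w r.
Proof.
move=> hl w01 /andP[r0 r1]; have /andP[w0 w1] := w01.
rewrite ltNge; apply/negP => Dr.
have : Delta l w 1 < 0.
  apply: (strictly_convex_lt0 (b := 2) (Delta_strictly_convex hl w01) _ _ _ Dr).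
  - by rewrite in_itv/= r0.
  - by rewrite in_itv/= andbT; lra.
  - by lra.
  - by rewrite Delta_at2.
rewrite Delta_at1//; lra.
Qed.

(** Nonpositive values at 2 and at [r > 3] would force a negative value at 3. *)
Lemma Delta_gt0_right (R : realType) (l : nat) (w r : R) :
  (2 <= l)%N -> 0 < w < 1 -> 3 <= r -> 0 < Delta l w r.
Proof.
move=> hl w01; have /andP[w0 w1] := w01.
have l2 : (2 : R) <= l%:R by rewrite ler_nat.
have D3 : 0 < Delta l w 3.
  rewrite Delta_at3// !mulr_gt0 ?subr_gt0// ltr_wpDl ?subr_ge0//.
  by rewrite !mulr_gt0//; lra.
rewrite le_eqVlt => /orP[/eqP<-//|r3]; rewrite ltNge; apply/negP => Dr.
have : Delta l w 3 < 0; last by rewrite ltNge ltW.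
have cvxD := Delta_strictly_convex (ltnW hl) w01.
apply: (strictly_convex_lt0 (a := 2) cvxD _ _ _ _ Dr).
- by rewrite in_itv/= andbT; lra.
- by rewrite in_itv/= andbT; lra.
- by lra.
- by rewrite Delta_at2.
Qed.

(** Otherwise [r] and the farther of the two zeros 2 and 4 would force a
    negative value at the nearer one. *)
Lemma Delta1_gt0 (R : realType) (w r : R) :
  0 < w < 1 -> 0 < r -> (r < 2) || (4 < r) -> 0 < Delta 1 w r.
Proof.
move=> w01 r0 hr; have /andP[w0 w1] := w01.
have cvxD := @Delta_strictly_convex R 1 w isT w01.
rewrite ltNge; apply/negP => Dr.
have [/andP[i2 i4] ir] :
    ((2 : R) \in `]0, +oo[) && ((4 : R) \in `]0, +oo[) /\ r \in `]0, +oo[.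
  by rewrite !in_itv/= r0; split => //; lra.
case/orP: hr => hr.
- have := strictly_convex_lt0 (c := 2) cvxD ir i4.
  by rewrite Delta_at2// Delta1_at4// hr ltxx ltr_nat => /(_ isT Dr (lexx _)).
- have := strictly_convex_lt0 (c := 4) cvxD i2 ir.
  by rewrite Delta_at2// Delta1_at4// hr ltxx ltr_nat => /(_ isT (lexx _) Dr).
Qed.

Lemma Delta1_lt0 (R : realType) (w r : R) :
  0 < w < 1 -> 2 < r < 4 -> Delta 1 w r < 0.
Proof.
move=> w01 hr; have /andP[w0 w1] := w01.
apply: (strictly_convex_lt0 (@Delta_strictly_convex R 1 w isT w01) _ _ hr).
- by rewrite in_itv/= andbT; lra.
- by rewrite in_itv/= andbT; lra.
- by rewrite Delta_at2.
- by rewrite Delta1_at4.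
Qed.

(** * The derivative and continuity of [Psi] *)

Lemma is_derive_powR_comp (R : realType) (a x dg : R) (g : R -> R) :
  0 < g x -> is_derive x 1 g dg ->
  is_derive x 1 (fun y => g y `^ a) (a * g x `^ (a - 1) * dg).
Proof.
move=> g0.
exact: (@is_derive1_comp R (fun y => y `^ a) g x _ _ (is_derive1_powR a g0)).
Qed.

Lemma powR_split (R : realType) (x s : R) : 0 < x -> x `^ s = x `^ (s - 1) * x.
Proof.
move=> x0; rewrite -[X in _ * X](powRr1 (ltW x0)) -powRD ?subrK//.
by rewrite (gt_eqF x0) implybT.
Qed.

Definition Psi_den (R : realType) (l : nat) (w : R) : R :=
  2 + 2 * l%:R * w + l%:R * (l%:R + 1) * w ^+ 2.

Lemma Psi_den_gt0 (R : realType) (l : nat) (w : R) :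
  0 <= w -> 0 < Psi_den l w.
Proof.
move=> w0; have lw : 0 <= l%:R * w by rewrite mulr_ge0.
by have := mulr_ge0 lw lw; have := mulr_ge0 lw w0; rewrite /Psi_den; lra.
Qed.

Lemma affine_gt0 (R : realType) (l : nat) (w : R) :
  0 <= w -> 0 < 1 + l%:R * w.
Proof. by move=> w0; rewrite ltr_wpDr// mulr_ge0. Qed.

Lemma is_derive_affine (R : realType) (l : nat) (w : R) :
  is_derive w 1 (fun x : R => 1 + l%:R * x) l%:R.
Proof.
have -> : (fun x : R => 1 + l%:R * x) = cst 1 + l%:R \*: id by [].
by apply: is_derive_eq; rewrite add0r /GRing.scale/= mulr1.
Qed.

Lemma is_derive_Psi_den (R : realType) (l : nat) (w : R) :
  is_derive w 1 (Psi_den l) (2 * l%:R * (1 + (l%:R + 1) * w)).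
Proof.
have -> : Psi_den l =
    cst (2 : R) + (2 * l%:R) \*: id + (l%:R * (l%:R + 1)) \*: id ^+ 2 by [].
by apply: is_derive_eq; rewrite /GRing.scale/=; ring.
Qed.

(** The quotient as a product of functions, the shape to which the rules of
    differentiation and of limits apply. *)
Lemma PsiE (R : realType) (l : nat) (r : R) :
  Psi l r =
  ((fun w => (1 + l%:R * w) `^ r) + cst 1 + l%:R \*: (fun w => w `^ r))
  * (fun w => Psi_den l w `^ (- (r / 2))).
Proof. by apply/funext => w; rewrite /Psi !fctE /= powRN. Qed.

(** The link between the two functions.  One factor is split off each power so
    that only the powers [P], [Q] and [S] below remain; the identity that is
    left holds with these as free variables. *)
Lemma is_derive_Psi (R : realType) (l : nat) (r w : R) : 0 < w ->
  is_derive w 1 (Psi l r)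
    (r * l%:R * Psi_den l w `^ (- (r / 2) - 1) * Delta l w r).
Proof.
move=> w0.
have a0 := affine_gt0 l (ltW w0); have D0 := Psi_den_gt0 l (ltW w0).
have dN := is_deriveD (is_deriveD
    (is_derive_powR_comp (g := fun x => 1 + l%:R * x) r a0
       (is_derive_affine l w))
    (is_derive_cst (1 : R) w 1))
    (is_deriveZ l%:R (is_derive1_powR r w0)).
have dD := is_derive_powR_comp (- (r / 2)) D0 (is_derive_Psi_den l w).
rewrite PsiE; apply: (is_derive_eq (is_deriveM dN dD)).
rewrite !fctE /GRing.scale/= /Delta (powR_split r a0) (powR_split r w0).
rewrite (powR_split (- (r / 2)) D0).
set P := Psi_den l w `^ _; set Q := _ `^ _; set S := _ `^ _.
by rewrite /Psi_den /GRing.scale/=; field.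
Qed.

Lemma is_derive_continuous (R : realType) (f : R -> R) (x df : R) :
  is_derive x 1 f df -> {for x, continuous f}.
Proof.
by move=> [df1 _]; apply: differentiable_continuous; apply/derivable1_diffP.
Qed.

(** The endpoint 0 needs its own argument: for [r < 1] the power [w `^ r] has no
    derivative there. *)
Lemma Psi_cvg0 (R : realType) (l : nat) (r : R) : 0 < r ->
  (Psi l r x @[x --> 0^'+] --> Psi l r 0)%classic.
Proof.
move=> r0; rewrite PsiE.
have cA := is_derive_continuous (is_derive_powR_comp
  (g := fun x => 1 + l%:R * x) r (affine_gt0 l (lexx 0))
  (is_derive_affine l 0)).
have cD := is_derive_continuous (is_derive_powR_comp
  (- (r / 2)) (Psi_den_gt0 l (lexx 0)) (is_derive_Psi_den l 0)).
have cw : (x `^ r @[x --> (0 : R)^'+] --> 0 `^ r)%classic.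
  by rewrite powR0 ?gt_eqF//; exact: powR_cvg0.
exact: (cvgM (cvgD (cvgD (cvg_at_right_filter cA) (cvg_cst (1 : R)))
  (cvgZl_tmp cw)) (cvg_at_right_filter cD)).
Qed.

Lemma Psi_within_continuous (R : realType) (l : nat) (r : R) : 0 < r ->
  {within `[0, 1], continuous (Psi l r)}%classic.
Proof.
move=> r0; apply/continuous_within_itvP; first exact: ltr01.
have cPsi x : 0 < x -> {for x, continuous (Psi l r)}.
  by move=> x0; apply: is_derive_continuous (is_derive_Psi l r x0).
split.
- by move=> x; rewrite in_itv/= => /andP[x0 _]; exact: cPsi.
- exact: Psi_cvg0.
- by apply: cvg_at_left_filter; exact: cPsi.
Qed.

(** * Monotonicity from the sign of [Delta] *)

Lemma Psi_incr (R : realType) (l : nat) (r : R) : (1 <= l)%N -> 0 < r ->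
  (forall w, 0 < w < 1 -> 0 < Delta l w r) ->
  {in `[0, 1] &, {homo Psi l r : x y / x < y}}.
Proof.
move=> hl r0 Dgt0.
apply: (gtr0_derive1_lt_cc (a := 0) (b := 1)) => [w|w|];
  last exact: Psi_within_continuous.
  by rewrite in_itv/= => /andP[/(is_derive_Psi l r)[]].
rewrite in_itv/= => w01; have /andP[w0 _] := w01.
have [_ dPsi] := is_derive_Psi l r w0.
rewrite derive1E dPsi !mulr_gt0 ?Dgt0 ?powR_gt0 ?Psi_den_gt0 ?ltW//.
by rewrite ltr0n.
Qed.

Lemma Psi_decr (R : realType) (l : nat) (r : R) : (1 <= l)%N -> 0 < r ->
  (forall w, 0 < w < 1 -> Delta l w r < 0) ->
  {in `[0, 1] &, {homo Psi l r : x y /~ x < y}}.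
Proof.
move=> hl r0 Dlt0.
apply: (ltr0_derive1_lt_cc (a := 0) (b := 1)) => [w|w|];
  last exact: Psi_within_continuous.
  by rewrite in_itv/= => /andP[/(is_derive_Psi l r)[]].
rewrite in_itv/= => w01; have /andP[w0 _] := w01.
have [_ dPsi] := is_derive_Psi l r w0.
rewrite derive1E dPsi pmulr_rlt0 ?Dlt0//.
by rewrite !mulr_gt0 ?powR_gt0 ?Psi_den_gt0 ?ltW// ltr0n.
Qed.

(** * The case [l = 1] at 2 and 4, and endpoint extrema *)

Lemma Psi1_at2 (R : realType) (w : R) : w \in `[0, 1] -> Psi 1 2 w = 1.
Proof.
rewrite in_itv/= => /andP[w0 _].
have a0 := affine_gt0 1 w0; have D0 := Psi_den_gt0 1 w0.
rewrite /Psi -/(Psi_den 1 w) divff ?pnatr_eq0// powRr1 ?(ltW D0)//.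
rewrite !powR_mulrn ?(ltW a0)//.
have -> : (1 + 1%:R * w) ^+ 2 + 1 + 1%:R * w ^+ 2 = Psi_den 1 w.
  by rewrite /Psi_den; ring.
by rewrite divff ?gt_eqF.
Qed.

Lemma Psi1_at4 (R : realType) (w : R) : w \in `[0, 1] -> Psi 1 4 w = 1 / 2.
Proof.
rewrite in_itv/= => /andP[w0 _].
have a0 := affine_gt0 1 w0; have D0 := Psi_den_gt0 1 w0.
rewrite /Psi -/(Psi_den 1 w) (_ : 4 / 2 = 2 :> R); last by field.
rewrite !powR_mulrn ?(ltW a0) ?(ltW D0)//.
have -> : (1 + 1%:R * w) ^+ 4 + 1 + 1%:R * w ^+ 4 = Psi_den 1 w ^+ 2 / 2.
  by rewrite /Psi_den; field.
by rewrite mulrAC divff ?mul1r// expf_neq0// gt_eqF.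
Qed.

Lemma homo_lt_endpoints (R : realType) (f : R -> R) :
  {in `[0, 1] &, {homo f : x y / x < y}} ->
  forall w, w \in `[0, 1] -> f 0 <= f w <= f 1.
Proof.
move=> /ltW_homo_in fincr w wI; have := wI; rewrite in_itv/= => /andP[w0 w1].
by rewrite !fincr ?in_itv/= ?lexx ?ler01.
Qed.

Theorem proposition12 (R : realType) (l : nat) (hl : (1 <= l)%N) :
  [/\ forall w : R, 0 < w < 1 ->
        [/\ strictly_convex_on `]0, +oo[ (Delta l w),
            Delta l w 1 = 2 * (1 - w)
          & Delta l w 2 = 0],
      forall r : R, 0 < r < 1 ->
        {in `[0, 1] &, {homo Psi l r : x y / x < y}},
      l = 1%N ->
        [/\ forall r : R, (1 < r < 2) || (4 < r) ->
              {in `[0, 1] &, {homo Psi l r : x y / x < y}},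
            forall r : R, 2 < r < 4 ->
              {in `[0, 1] &, {homo Psi l r : x y /~ x < y}},
            forall w : R, w \in `[0, 1] -> Psi l 2 w = 1,
            forall w : R, w \in `[0, 1] -> Psi l 4 w = 1 / 2
          & forall r : R, 0 < r ->
              (exists2 a : R, a \in [:: 0; 1] &
                 forall w : R, w \in `[0, 1] -> Psi l r a <= Psi l r w) /\
              (exists2 b : R, b \in [:: 0; 1] &
                 forall w : R, w \in `[0, 1] -> Psi l r w <= Psi l r b)]
    & (2 <= l)%N -> forall r : R, 3 <= r ->
        {in `[0, 1] &, {homo Psi l r : x y / x < y}}].
Proof.
split.
- move=> w w01; have /andP[w0 _] := w01.
  by split; [exact: Delta_strictly_convex|exact: Delta_at1|exact: Delta_at2].
- move=> r r01; have /andP[r0 _] := r01.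
  by apply: Psi_incr => // w w01; exact: Delta_gt0_left.
- move=> ->.
  have incr (r : R) : 0 < r -> (r < 2) || (4 < r) ->
      {in `[0, 1] &, {homo Psi 1 r : x y / x < y}}.
    by move=> r0 hr; apply: Psi_incr => // w w01; exact: Delta1_gt0.
  have decr (r : R) : 2 < r < 4 ->
      {in `[0, 1] &, {homo Psi 1 r : x y /~ x < y}}.
    move=> hr; apply: Psi_decr => //; first by lra.
    by move=> w w01; exact: Delta1_lt0.
  split => //; [|exact: Psi1_at2|exact: Psi1_at4|].
    by move=> r hr; apply: incr; lra.
  move=> r r0.
  have z01 : (0 : R) \in [:: 0; 1] by rewrite !inE eqxx.
  have o01 : (1 : R) \in [:: 0; 1] by rewrite !inE eqxx orbT.
  have [I0 I1] : (0 : R) \in `[0, 1] /\ (1 : R) \in `[0, 1].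
    by rewrite !in_itv/= !lexx ler01.
  have [hr|] := boolP ((r < 2) || (4 < r)).
    have bd := homo_lt_endpoints (incr r r0 hr).
    by split; [exists 0|exists 1] => // w /bd/andP[].
  rewrite negb_or -!leNgt => /andP[].
  rewrite le_eqVlt => /orP[/eqP<- _|r2].
    by split; exists 0 => // w wI; rewrite !Psi1_at2.
  rewrite le_eqVlt => /orP[/eqP->|r4].
    by split; exists 0 => // w wI; rewrite !Psi1_at4.
  have hr : 2 < r < 4 by rewrite r2.
  have bd w : w \in `[0, 1] -> Psi 1 r 1 <= Psi 1 r w <= Psi 1 r 0.
    move=> wI; rewrite andbC -lerN2 -[X in _ && X]lerN2.
    apply: (homo_lt_endpoints (f := fun x => - Psi 1 r x)) wI => x y xI yI xy.
    by rewrite ltrN2; exact: (decr r hr).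
  by split; [exists 1|exists 0] => // w /bd/andP[].
- move=> l2 r r3; apply: Psi_incr => //; first by lra.
  by move=> w w01; exact: Delta_gt0_right.
Qed.
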